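(* For positive integers $z$: \begin{align*} z\in S_{1,2,3}&\iff z\in\{1,5,13\}\ \text{ or }\ z\bmod 23\in\{2,3,4,14,15\};\\ z\in S_{1,3,4}&\iff z\in\{1,7,19\}\ \text{ or }\ z\bmod 33\in\{3,4,5,6,20,21,22\};\\ z\in S_{1,4,5}&\iff z\in\{1,9,25\}\ \text{ or }\ z\bmod 43\in\{4,5,6,7,8,26,27,28,29\}. \end{align*}
   Context: For positive integers $x<y<z$, the greedy 3-subsumfree sequence $S_{x,y,z}$ is the sequence $(a_n)_{n\ge 1}$ with $a_1=x$, $a_2=y$, $a_3=z$ and, for $n>3$, $a_n$ is the smallest integer exceeding $a_{n-1}$ that is not the sum of three different previous entries, i.e. $a_n\ne a_i+a_j+a_k$ for all $1\le i<j<k<n$. We write $w\in S_{x,y,z}$ if $w$ is an entry of this sequence. Here $z\bmod m$ denotes the remainder in $\{0,1,\ldots,m-1\}$ of $z$ on division by $m$. *)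

(* Defs.v *)
From mathcomp Require Import all_boot.

Set Implicit Arguments.
Unset Strict Implicit.
Unset Printing Implicit Defensive.

Definition sum_of_three (s : seq nat) (m : nat) : bool :=
  [exists i : 'I_(size s), exists j : 'I_(size s), exists k : 'I_(size s),
    [&& i < j, j < k & m == nth 0 s i + nth 0 s j + nth 0 s k]].

Lemma sum_of_threeP (s : seq nat) (m : nat) :
  reflect (exists i j k, [/\ i < j, j < k, k < size s
             & m = nth 0 s i + nth 0 s j + nth 0 s k])
          (sum_of_three s m).
Proof.
apply: (iffP existsP) => [[i /existsP[j /existsP[k /and3P[ij jk /eqP ->]]]]|].
  by exists i, j, k; split.
case=> i [j [k [ij jk ks ->]]].
have js := ltn_trans jk ks; have si := ltn_trans ij js.
exists (Ordinal si); apply/existsP; exists (Ordinal js); apply/existsP.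
by exists (Ordinal ks); rewrite /= ij jk eqxx.
Qed.

Lemma greedy_next_ex (s : seq nat) :
  exists m, (last 0 s < m) && ~~ sum_of_three s m.
Proof.
pose M := foldr maxn 0 s.
have leM i : nth 0 s i <= M.
  rewrite {}/M; elim: s i => [|a s IHs] [|i] //=; first exact: leq_maxl.
  exact: leq_trans (IHs i) (leq_maxr _ _).
exists (M + M + M).+1; apply/andP; split.
  by rewrite ltnS -nth_last (leq_trans (leM _)) // -addnA leq_addr.
apply/sum_of_threeP => -[i [j [k [_ _ _ E]]]].
by have := leq_add (leq_add (leM i) (leM j)) (leM k); rewrite -E ltnn.
Qed.

Definition greedy_next (s : seq nat) : nat := ex_minn (greedy_next_ex s).

Definition greedy_prefix (x y z n : nat) : seq nat :=
  iter n (fun s => rcons s (greedy_next s)) [:: x; y; z].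

(* The entry a_n, with n counted from 1 (the value at n = 0 is junk);
   greedy_prefix x y z n lists a_1, ..., a_(n+3). *)
Definition greedy_seq (x y z n : nat) : nat :=
  nth 0 (greedy_prefix x y z n) n.-1.

Definition in_greedy_seq (x y z w : nat) : Prop :=
  exists2 n, 0 < n & w = greedy_seq x y z n.

(* Here a 0 is irrelevant: entries are numbered from 1, hence 0 < i.
   greedy_seq is the unique sequence with this property, by greedy_seqP and
   is_greedy_uniq below. *)
Definition three_previous_sum (a : nat -> nat) (n m : nat) : Prop :=
  exists i j k, [/\ 0 < i, i < j, j < k, k < n & m = a i + a j + a k].

Definition is_greedy_3subsumfree (x y z : nat) (a : nat -> nat) : Prop :=
  [/\ a 1 = x, a 2 = y, a 3 = z
    & forall n, 3 < n ->
        [/\ a n.-1 < a n, ~ three_previous_sum a n (a n)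
          & forall m, a n.-1 < m -> ~ three_previous_sum a n m -> a n <= m]].

Lemma size_greedy_prefix x y z n : size (greedy_prefix x y z n) = n.+3.
Proof. by elim: n => //= n IHn; rewrite size_rcons IHn. Qed.

Lemma nth_greedy_prefix x y z n i :
  i < n.+3 -> nth 0 (greedy_prefix x y z n) i = greedy_seq x y z i.+1.
Proof.
have stable p q : i < p.+3 -> nth 0 (greedy_prefix x y z (q + p)) i
                            = nth 0 (greedy_prefix x y z p) i.
  move=> ip; elim: q => //= q IHq.
  rewrite nth_rcons size_greedy_prefix ifT //.
  by apply: leq_trans ip _; rewrite !ltnS leq_addl.
move=> i_n; rewrite /greedy_seq /= -(stable n i.+1 i_n) addnC.
by rewrite stable //; exact: (leq_addl 3 i.+1).
Qed.

Lemma greedy_seqP x y z : is_greedy_3subsumfree x y z (greedy_seq x y z).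
Proof.
split=> // -[|[|[|[|n]]]] // _.
pose s := greedy_prefix x y z n.
have szs : size s = n.+3 := size_greedy_prefix x y z n.
have -> : greedy_seq x y z n.+4 = greedy_next s.
  by rewrite -(@nth_greedy_prefix x y z n.+1) //= nth_rcons szs ltnn eqxx.
have lasts : greedy_seq x y z n.+4.-1 = last 0 s.
  by rewrite -nth_last szs nth_greedy_prefix.
have sumE m : three_previous_sum (greedy_seq x y z) n.+4 m <-> sum_of_three s m.
  split=> [[[|i] [[|j] [[|k] [//_ ij jk kn ->]]]]|].
    apply/sum_of_threeP; exists i, j, k; rewrite szs; split=> //.
    have jn := ltn_trans jk kn; have i_n := ltn_trans ij jn.
    by rewrite !nth_greedy_prefix.
  case/sum_of_threeP=> i [j [k [ij jk]]]; rewrite szs => kn ->.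
  have jn := ltn_trans jk kn; have i_n := ltn_trans ij jn.
  by exists i.+1, j.+1, k.+1; split=> //; rewrite !nth_greedy_prefix.
rewrite lasts /greedy_next; case: ex_minnP => v /andP[lt_v nsum_v] min_v.
split=> // [/sumE|m lt_m nsum_m]; first exact/negP.
by apply: min_v; rewrite lt_m; apply/negP => /sumE.
Qed.

Lemma is_greedy_uniq x y z a b n :
  is_greedy_3subsumfree x y z a -> is_greedy_3subsumfree x y z b ->
  0 < n -> a n = b n.
Proof.
move=> [a1 a2 a3 aP] [b1 b2 b3 bP].
elim/ltn_ind: n => n IHn n_gt0.
case: (leqP n 3) => [|n_gt3].
  by case: n n_gt0 {IHn} => [|[|[|[|n]]]] // _ _; congruence.
have predE : a n.-1 = b n.-1.
  by apply: IHn; rewrite ?ltn_predL // -ltnS prednK // (ltn_trans _ n_gt3).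
have sumE m : three_previous_sum a n m <-> three_previous_sum b n m.
  split=> -[i [j [k [i0 ij jk kn ->]]]]; exists i, j, k; split=> //;
    have j0 := ltn_trans i0 ij; have k0 := ltn_trans j0 jk;
    have jn := ltn_trans jk kn; have i_n := ltn_trans ij jn;
    by rewrite !IHn.
have [lt_a nsum_a min_a] := aP n n_gt3; have [lt_b nsum_b min_b] := bP n n_gt3.
apply/eqP; rewrite eqn_leq; apply/andP; split.
  by apply: min_a; [rewrite predE | move/sumE].
by apply: min_b; [rewrite -predE | move/sumE].
Qed.

(* Main.v *)
(** If [P] agrees with [x, y, z] up to [z] and, beyond [z], holds exactly at the
    numbers that are not sums of three distinct elements of [P], then [P] is the
    range of the greedy sequence.  The sets of the theorem are a finite set [E]
    of numbers below [m] together with the residue classes modulo [m] of a set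
    [R].  Beyond [3 m] the required property only depends on residues: no sum of
    three elements, using each element of [E] at most once, falls in [R] modulo
    [m], and every residue outside [R] is [a + b + c] modulo [m] for two distinct
    elements [a, b < m] and some [c] in [R].  What remains is finite. *)

Require Import Defs.
From mathcomp Require Import all_boot.

Set Implicit Arguments.
Unset Strict Implicit.
Unset Printing Implicit Defensive.

Definition distinct_sum3 (P : nat -> Prop) (w : nat) : Prop :=
  exists a b c, [/\ P a, P b & P c] /\ [/\ a < b, b < c & w = a + b + c].

(** * The range of the greedy sequence *)

Section GreedyRange.

Variables x y z : nat.
Hypotheses (lt_xy : x < y) (lt_yz : y < z).

Local Notation a := (greedy_seq x y z).

Lemma greedy_seq_ltS n : 0 < n -> a n < a n.+1.
Proof.
have [a1 a2 a3 aP] := greedy_seqP x y z.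
case: n => [|[|[|n]]] // _; rewrite ?a1 ?a2 ?a3 //.
by have [] := aP n.+4 isT.
Qed.

Lemma greedy_seq_lt i j : 0 < i -> i < j -> a i < a j.
Proof.
move=> i_gt0; elim: j => // j IHj; rewrite ltnS leq_eqVlt => /predU1P[<-|ij].
  exact: greedy_seq_ltS.
exact: ltn_trans (IHj ij) (greedy_seq_ltS (ltn_trans i_gt0 ij)).
Qed.

Lemma greedy_seq_lt_inv i j : 0 < j -> a i < a j -> i < j.
Proof.
move=> j_gt0 lt_a; rewrite ltnNge leq_eqVlt; apply/negP => /predU1P[eq_ji|ji].
  by rewrite eq_ji ltnn in lt_a.
by have := ltn_trans lt_a (greedy_seq_lt j_gt0 ji); rewrite ltnn.
Qed.

Lemma greedy_seq_ge n : n.-1 <= a n.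
Proof.
case: n => // n; elim: n => // n IHn.
exact: leq_ltn_trans IHn (greedy_seq_ltS _).
Qed.

Lemma in_greedy_seq_le w :
  w <= z -> in_greedy_seq x y z w <-> w \in [:: x; y; z].
Proof.
have [a1 a2 a3 _] := greedy_seqP x y z.
move=> w_le; split=> [[n n_gt0 def_w]|].
  have: n < 4.
    apply: greedy_seq_lt_inv => //; rewrite -def_w (leq_ltn_trans w_le) //.
    by rewrite -[X in X < _]a3 greedy_seq_lt.
  by case: n n_gt0 def_w => [|[|[|[|n]]]] // _ -> _;
     rewrite ?a1 ?a2 ?a3 !inE eqxx ?orbT.
by rewrite !inE => /or3P[]/eqP->; [exists 1 | exists 2 | exists 3].
Qed.

(** As the sequence increases strictly, ordering indices amounts to ordering values, and entries
    that sum to [w] automatically precede [w]. *)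
Lemma in_greedy_seq_gt w :
  z < w -> in_greedy_seq x y z w <-> ~ distinct_sum3 (in_greedy_seq x y z) w.
Proof.
have [_ _ a3 aP] := greedy_seqP x y z.
have gt3 n : z < a n -> 3 < n.
  move=> lt_z; rewrite ltnNge; apply/negP => n_le3.
  (* Index 0 carries the junk value [x], which lies below [z]. *)
  have [n0|n_gt0] := posnP n.
    have a0 : a n = x by rewrite n0.
    by have := ltn_trans lt_xy (ltn_trans lt_yz lt_z); rewrite a0 ltnn.
  move: n_le3; rewrite leq_eqVlt => /predU1P[n3|n_lt3].
    by rewrite n3 a3 ltnn in lt_z.
  by have := ltn_trans lt_z (greedy_seq_lt n_gt0 n_lt3); rewrite a3 ltnn.
move=> w_gt; split.
  case=> n n_gt0 def_w.
  case=> _ [_ [_ [[[i i0 ->] [j j0 ->] [k k0 ->]] [lt_ij lt_jk sum_w]]]].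
  have [_ nsum _] := aP n (gt3 n ltac:(by rewrite -def_w)).
  apply: nsum; exists i, j, k; rewrite -def_w; split=> //.
  - exact: greedy_seq_lt_inv lt_ij.
  - exact: greedy_seq_lt_inv lt_jk.
  - apply: greedy_seq_lt_inv => //; rewrite -def_w sum_w.
    rewrite -[X in X < _]add0n ltn_add2r addn_gt0; apply/orP; right.
    exact: leq_ltn_trans lt_ij.
(* For the least [n] with [w <= a n], the entry [a n.-1] is below [w], so minimality of the greedy
   choice forces [a n <= w]. *)
move=> nsum; have ex_n : exists n, w <= a n.
  by exists w.+1; exact: greedy_seq_ge w.+1.
case: (ex_minnP ex_n) => n w_le min_n.
have n_gt3 : 3 < n by apply: gt3; exact: leq_trans w_gt w_le.
have n_gt0 : 0 < n by exact: leq_trans n_gt3.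
exists n => //; apply/eqP; rewrite eqn_leq w_le /=.
have [_ _] := aP n n_gt3; apply.
  by rewrite ltnNge; apply/negP => /min_n; rewrite leqNgt ltn_predL n_gt0.
case=> i [j [k [i0 ij jk kn def_w]]].
have j0 := ltn_trans i0 ij; have k0 := ltn_trans j0 jk.
apply: nsum; exists (a i), (a j), (a k).
by split; split; rewrite ?greedy_seq_lt //; [exists i | exists j | exists k].
Qed.

(** Strong induction works because the middle one of three distinct summands is positive, so all
    three are below [w]. *)
Lemma in_greedy_seq_char (P : pred nat) :
    (forall w, w <= z -> P w = (w \in [:: x; y; z])) ->
    (forall w, z < w -> P w <-> ~ distinct_sum3 P w) ->
  forall w, in_greedy_seq x y z w <-> P w.
Proof.
move=> P_le P_gt; elim/ltn_ind => w IHw.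
have [w_le|w_gt] := leqP w z; first by rewrite P_le //; exact: in_greedy_seq_le.
have sumE : distinct_sum3 (in_greedy_seq x y z) w <-> distinct_sum3 P w.
  split=> -[i [j [k [[Si Sj Sk] [ij jk def_w]]]]]; exists i, j, k;
    (have k_lt : k < w by rewrite def_w -[X in X < _]add0n ltn_add2r addn_gt0
       (leq_ltn_trans _ ij) ?orbT);
    have j_lt := ltn_trans jk k_lt; have i_lt := ltn_trans ij j_lt;
    by split; split=> //; apply/IHw.
apply: iff_trans (in_greedy_seq_gt w_gt) _.
apply: iff_trans (iff_sym (P_gt w w_gt)).
by split=> nsum /sumE.
Qed.

End GreedyRange.

(** * Residue classes with finitely many exceptions *)

Section Periodic.

Variables (m : nat) (E R : seq nat).

Definition eperiodic : pred nat := fun w => (w \in E) || (w %% m \in R).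

(** Two summands determine the third, so evaluation searches pairs only. *)
Definition distinct_sum3b (P : pred nat) (w : nat) : bool :=
  let s := [seq a <- iota 0 w.+1 | P a] in
  has (fun a => has (fun b =>
    [&& a < b, b < w - (a + b), a + b <= w & P (w - (a + b))]) s) s.

Lemma distinct_sum3P (P : pred nat) w :
  reflect (distinct_sum3 P w) (distinct_sum3b P w).
Proof.
apply: (iffP hasP) => [[a]|[a [b [c [[Pa Pb Pc] [ab bc def_w]]]]]].
  rewrite mem_filter => /andP[Pa _] /hasP[b].
  rewrite mem_filter => /andP[Pb _] /and4P[ab bc ab_le Pc].
  by exists a, b, (w - (a + b)); rewrite subnKC.
have wE : w - (a + b) = c by rewrite def_w addKn.
exists a.
  by rewrite mem_filter Pa mem_iota ltnS def_w -addnA leq_addr.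
apply/hasP; exists b.
  by rewrite mem_filter Pb mem_iota ltnS def_w addnAC leq_addl.
by rewrite wE ab bc Pc def_w leq_addr.
Qed.

Definition small_check (z : nat) : bool :=
  all (fun w => eperiodic w == ~~ distinct_sum3b eperiodic w)
      (iota z.+1 (3 * m)).

(* Members of [R] stand for whole residue classes and may repeat; an element of
   [E] stands only for itself. *)
Definition sumfree_check : bool :=
  let s := E ++ R in
  all (fun a => all (fun b => all (fun c =>
    uniq [seq e <- [:: a; b; c] | e \in E] ==> ((a + b + c) %% m \notin R))
  s) s) s.

Definition cover_check : bool :=
  let s := [seq a <- iota 0 m | eperiodic a] in
  all (fun r => (r \in R) || has (fun a => has (fun b => has (fun c =>
    (a < b) && ((a + b + c) %% m == r)) R) s) s) (iota 0 m).

Hypotheses (m_gt0 : 0 < m) (E_lt : all (gtn m) E) (R_lt : all (gtn m) R).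
Hypothesis R_E : all (predC (mem E)) R.

(** The entry of [E ++ R] that [sumfree_check] tests in place of a member [a]. *)
Let rep a := if a \in E then a else a %% m.

Lemma rep_mod a : rep a %% m = a %% m.
Proof. by rewrite /rep; case: ifP => // _; rewrite modn_mod. Qed.

Lemma rep_mem a : eperiodic a -> rep a \in E ++ R.
Proof.
rewrite /eperiodic /rep mem_cat.
by case: ifP => [->|_ /= ->] //; rewrite orbT.
Qed.

(** Since [R] avoids [E], reducing a member outside [E] never lands in [E]; so distinct members
    still use each exception at most once. *)
Lemma rep_filter s : all eperiodic s ->
  [seq e <- map rep s | e \in E] = [seq e <- s | e \in E].
Proof.
elim: s => //= a s IHs /andP[Pa /IHs ->].
move: Pa; rewrite /eperiodic /rep; case: (boolP (a \in E)) => [-> //|_ /= Ra].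
by have /negbTE /= -> := allP R_E _ Ra.
Qed.

Lemma sumfree_checkP w : sumfree_check ->
  distinct_sum3 eperiodic w -> w %% m \notin R.
Proof.
move=> chk [a [b [c [[Pa Pb Pc] [ab bc ->]]]]].
have -> : (a + b + c) %% m = (rep a + rep b + rep c) %% m.
  by rewrite -[LHS]modnDm -(modnDm a) -[RHS]modnDm -(modnDm (rep a)) !rep_mod.
have := allP (allP (allP chk _ (rep_mem Pa)) _ (rep_mem Pb)) _ (rep_mem Pc).
move/implyP; apply.
rewrite (rep_filter (s := [:: a; b; c])); last by rewrite /= Pa Pb Pc.
by rewrite filter_uniq //= !inE negb_or !neq_ltn ab bc (ltn_trans ab bc).
Qed.

(** The third summand [w - (a + b)] is congruent to [c], and it exceeds [b] because
    [a + b + b < 3 * m]. *)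
Lemma cover_checkP w : cover_check -> 3 * m <= w -> w %% m \notin R ->
  distinct_sum3 eperiodic w.
Proof.
move=> chk w_ge /negbTE notR.
have /(allP chk) : w %% m \in iota 0 m by rewrite mem_iota ltn_pmod.
rewrite notR => /hasP[a]; rewrite mem_filter mem_iota => /andP[Pa /= a_lt].
case/hasP=> b; rewrite mem_filter mem_iota => /andP[Pb /= b_lt].
case/hasP=> c Rc /andP[ab /eqP def_r].
have lt_abb : a + b + b < w.
  apply: leq_trans w_ge; rewrite !mulSn mul0n addn0 addnA.
  by rewrite -addSn leq_add ?(ltnW b_lt) // -addSn leq_add // ltnW.
have le_w : a + b <= w by apply: leq_trans (ltnW lt_abb); rewrite leq_addr.
exists a, b, (w - (a + b)); rewrite subnKC //; do 2!split=> //.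
  rewrite /eperiodic; suff -> : (w - (a + b)) %% m = c %% m.
    by rewrite modn_small ?Rc ?orbT //; exact: (allP R_lt).
  by apply/eqP; rewrite -(eqn_modDl (a + b)) subnKC // def_r.
by rewrite ltn_subRL.
Qed.

Lemma eperiodicP z w : small_check z -> sumfree_check -> cover_check ->
  z < w -> eperiodic w <-> ~ distinct_sum3 eperiodic w.
Proof.
move=> small sumfree cover w_gt; have [w_lt|w_ge] := ltnP w (3 * m).
  have /(allP small)/eqP-> : w \in iota z.+1 (3 * m).
    by rewrite mem_iota w_gt ltn_addl.
  split=> [/negP nsum /distinct_sum3P //|nsum].
  by apply/negP => /distinct_sum3P.
(* Exceptions are below [m], so only the residue decides here. *)
have Pw : eperiodic w = (w %% m \in R).
  rewrite /eperiodic; case: (boolP (w \in E)) => // /(allP E_lt) /= w_lt.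
  by have := leq_ltn_trans w_ge w_lt; rewrite ltnNge leq_pmull.
rewrite Pw; split=> [Rw|nsum].
  by move/(sumfree_checkP sumfree); rewrite Rw.
by apply/negPn/negP => /(cover_checkP cover w_ge).
Qed.

Lemma in_greedy_seq_eperiodic x y z w : x < y -> y < z ->
    all (fun v => eperiodic v == (v \in [:: x; y; z])) (iota 0 z.+1) ->
    small_check z -> sumfree_check -> cover_check ->
  in_greedy_seq x y z w <-> (w \in E) \/ (w %% m \in R).
Proof.
move=> lt_xy lt_yz init small sumfree cover.
apply: (iff_trans (in_greedy_seq_char lt_xy lt_yz (P := eperiodic) _ _ w)).
- by move=> v v_le; apply/eqP/(allP init); rewrite mem_iota.
- by move=> v; exact: eperiodicP.
by split=> /orP.
Qed.

End Periodic.

Theorem theorem4 (z : nat) (z_gt0 : 0 < z) :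
  [/\ in_greedy_seq 1 2 3 z <->
        (z \in [:: 1; 5; 13]) \/ (z %% 23 \in [:: 2; 3; 4; 14; 15]),
      in_greedy_seq 1 3 4 z <->
        (z \in [:: 1; 7; 19]) \/ (z %% 33 \in [:: 3; 4; 5; 6; 20; 21; 22])
    & in_greedy_seq 1 4 5 z <->
        (z \in [:: 1; 9; 25]) \/
        (z %% 43 \in [:: 4; 5; 6; 7; 8; 26; 27; 28; 29])].
(* All side conditions are closed booleans, settled by evaluation. *)
Proof. by split; apply: in_greedy_seq_eperiodic; vm_compute. Qed.
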